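(* Let $n>2$ and $t>2$ be two positive integers. Then \[\varphi(C_n \boxdot C_t) = \begin{cases} 5, & \text{if } n\in\{3,4\},\\ n, & \text{if } 5\leq n\leq 2t+2,\\ 2t+3, & \text{otherwise}. \end{cases}\]
   Context: All graphs are finite and simple. $C_n$ denotes the cycle with $n$ vertices. The subdivision graph $S(G)$ of a graph $G$ is obtained by inserting one new vertex into every edge of $G$. For graphs $G$ and $H$, with $V(G)=\{u_0,\ldots,u_{m-1}\}$, the subdivision-vertex neighbourhood corona (SVN corona) $G\boxdot H$ is the graph obtained from $S(G)$ by adding $m$ vertex-disjoint copies of $H$ (one for each $u_i$) and joining, for each $i$, every vertex of $N_{S(G)}(u_i)$ (the neighbourhood of $u_i$ in $S(G)$) to every vertex of the copy of $H$ associated with $u_i$. A $b$-chromatic coloring of a graph with $k$ colors is a proper coloring with colors $0,\ldots,k-1$ such that, for each color $i$, there is a vertex (a $b$-vertex) of color $i$ having, for each color $j\neq i$, a neighbour of color $j$. The $b$-chromatic number $\varphi(G)$ is the maximum $k$ for which $G$ has a $b$-chromatic coloring with $k$ colors. *)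

(* Defs.v *)
From mathcomp Require Import all_boot.

Set Implicit Arguments.
Unset Strict Implicit.
Unset Printing Implicit Defensive.

Record sgraph := SGraph {
  vertex :> finType;
  adj : rel vertex;
  adj_sym : symmetric adj;
  adj_irr : irreflexive adj }.

Notation "x -- y" := (adj x y) (at level 30).

Definition neighbours (G : sgraph) (x : G) : {set G} := [set y | x -- y].

Definition edges (G : sgraph) : {set {set G}} :=
  [set [set p.1; p.2] | p : G * G & p.1 -- p.2].

Section Subdivision.
Variable G : sgraph.

Notation edge_vertex := {e : {set G} | e \in edges G}.

Definition subdiv_adj (a b : G + edge_vertex) : bool :=
  match a, b with
  | inl u, inr e | inr e, inl u => u \in val e
  | _, _ => false
  end.

Lemma subdiv_adj_sym : symmetric subdiv_adj.
Proof. by case=> [u|e] [v|f]. Qed.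

Lemma subdiv_adj_irr : irreflexive subdiv_adj.
Proof. by case. Qed.

Definition subdivision : sgraph := SGraph subdiv_adj_sym subdiv_adj_irr.

End Subdivision.

Section Corona.
Variables G H : sgraph.

(* [inr (u, h)] is the vertex [h] in the copy of [H] associated with [u]. *)
Definition svn_adj (a b : subdivision G + G * H) : bool :=
  match a, b with
  | inl x, inl y => x -- y
  | inl x, inr (u, _) | inr (u, _), inl x =>
      x \in neighbours (inl u : subdivision G)
  | inr (u, h), inr (v, k) => (u == v) && (h -- k)
  end.

Lemma svn_adj_sym : symmetric svn_adj.
Proof.
case=> [x|[u h]] [y|[v k]] //=; first exact: subdiv_adj_sym.
by rewrite eq_sym adj_sym.
Qed.

Lemma svn_adj_irr : irreflexive svn_adj.
Proof. by case=> [x|[u h]] /=; rewrite ?subdiv_adj_irr ?adj_irr ?andbF. Qed.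

Definition svn_corona : sgraph := SGraph svn_adj_sym svn_adj_irr.

End Corona.

Section Cycle.
Variable n : nat.

(* [ordS] is the successor modulo [n].  The conjunct [i != j] only matters
   for [n = 1]; the graph is the cycle C_n for [2 < n]. *)
Definition cycle_adj (i j : 'I_n) : bool :=
  (i != j) && ((j == ordS i) || (i == ordS j)).

Lemma cycle_adj_sym : symmetric cycle_adj.
Proof. by move=> i j; rewrite /cycle_adj eq_sym orbC. Qed.

Lemma cycle_adj_irr : irreflexive cycle_adj.
Proof. by move=> i; rewrite /cycle_adj eqxx. Qed.

Definition cycle_graph : sgraph := SGraph cycle_adj_sym cycle_adj_irr.

End Cycle.

Section BColoring.
Variable G : sgraph.

Definition proper_coloring k (c : {ffun G -> 'I_k}) : bool :=
  [forall x : G, forall y : G, x -- y ==> (c x != c y)].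

Definition b_vertex k (c : {ffun G -> 'I_k}) (x : G) : bool :=
  [forall j : 'I_k, (j != c x) ==> [exists y in neighbours x, c y == j]].

Definition b_coloring k (c : {ffun G -> 'I_k}) : bool :=
  proper_coloring c &&
  [forall i : 'I_k, exists x : G, (c x == i) && b_vertex c x].

Definition b_colorable (k : nat) : bool :=
  [exists c : {ffun G -> 'I_k}, b_coloring c].

(* Every color of a b-coloring is used, so bounding [k] by the number of
   vertices loses nothing: see [b_colorable_leq_card]. *)
Definition b_chromatic_number : nat :=
  \max_(k < #|G|.+1 | b_colorable k) k.

Lemma b_colorable_leq_card k : b_colorable k -> k <= #|G|.
Proof.
case/existsP=> c /andP[_ /forallP bc].
have im_c: c @: [set: G] = [set: 'I_k].
  apply/setP=> i; rewrite inE; apply/imsetP.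
  by case/existsP: (bc i) => x /andP[/eqP <- _]; exists x.
by rewrite -[k]card_ord -!cardsT -[in leqLHS]im_c leq_imset_card.
Qed.

Lemma b_colorable_leq k : b_colorable k -> k <= b_chromatic_number.
Proof.
move=> bk; have lt_k : k < #|G|.+1 by rewrite ltnS b_colorable_leq_card.
exact: (@leq_bigmax_cond _ _ (fun k : 'I_ _ => val k) (Ordinal lt_k)).
Qed.

End BColoring.

(* Main.v *)
(* The vertices of the cycle have degree 2 in the corona, those of the copies
   degree 4, and the n edge vertices degree 2t + 2.  With at least 6 colours,
   all b-vertices are therefore edge vertices, which bounds the number of
   colours by n and by 2t + 3.  Conversely, up to min(n, 2t + 3) colours are
   realized by giving distinct colours to consecutive edge vertices and making
   them b-vertices; for n = 3, 4 there are not enough edge vertices for 5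
   colours, and vertices of the copies serve as b-vertices of the others. *)
Require Import Defs.
From mathcomp Require Import all_boot zify.

Set Implicit Arguments.
Unset Strict Implicit.
Unset Printing Implicit Defensive.

Lemma modnS_lt {n i} : i < n -> i.+1 %% n = if i.+1 == n then 0 else i.+1.
Proof.
move=> lt_in; case: eqP => [->|ne]; first exact: modnn.
by rewrite modn_small //; lia.
Qed.

(** * Vertices, adjacency and degrees in the corona of two cycles *)

Section CycleCorona.
Variables n t : nat.
Hypothesis hn : 2 < n.

Notation C := (cycle_graph n).
Notation G := (svn_corona C (cycle_graph t)).
Notation edge_vertex := {e : {set C} | e \in edges C}.

Lemma cycle_adj_ordS m (i : 'I_m) : 1 < m -> cycle_adj i (ordS i).
Proof.
move=> m_gt1; rewrite /cycle_adj eqxx orTb andbT -val_eqE /=.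
by have lt_im := ltn_ord i; rewrite modnS_lt //; case: ifP; lia.
Qed.

Lemma cycle_edge_subproof (i : 'I_n) : [set i; ordS i] \in edges C.
Proof.
apply/imsetP; exists (i, ordS i) => //.
by rewrite inE; apply: cycle_adj_ordS; lia.
Qed.

Definition cycle_edge (i : 'I_n) : edge_vertex :=
  exist _ [set i; ordS i] (cycle_edge_subproof i).

(** Two indices of the same edge would be successors of each other, forcing [n] to divide 2. *)
Lemma cycle_edge_inj : injective cycle_edge.
Proof.
move=> i j /(congr1 val) /= eq_ij; apply/eqP; rewrite -val_eqE /=.
have: i \in [set j; ordS j] by rewrite -eq_ij !inE eqxx.
have: ordS i \in [set j; ordS j] by rewrite -eq_ij !inE eqxx orbT.
have := ltn_ord i; have := ltn_ord j.
rewrite !inE -!val_eqE /= => ltj lti; rewrite (modnS_lt ltj) (modnS_lt lti).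
by repeat case: ifP; lia.
Qed.

(** The sigma type makes the index of an edge available as a function, used to define colourings. *)
Lemma cycle_edge_surj (e : edge_vertex) : {i | e = cycle_edge i}.
Proof.
suff /sigW[i /eqP ->] : exists i, e == cycle_edge i by exists i.
case: e => e e_edge; have /imsetP[[a b]] := e_edge.
rewrite inE /= => /andP[_ /orP[]] /eqP /= E eE.
  by exists a; rewrite -val_eqE /= eE E.
by exists b; rewrite -val_eqE /= eE E setUC.
Qed.

Definition uv (i : 'I_n) : G := inl (inl i).
Definition ev (i : 'I_n) : G := inl (inr (cycle_edge i)).
Definition hv (i : 'I_n) (h : 'I_t) : G := inr (i, h).

Variant vertex_spec : G -> Type :=
  | VertexU i : vertex_spec (uv i)
  | VertexE i : vertex_spec (ev i)
  | VertexH i h : vertex_spec (hv i h).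

Lemma vertexP (x : G) : vertex_spec x.
Proof.
case: x => [[i|e]|[i h]]; first exact: VertexU; last exact: VertexH.
by have [i ->] := cycle_edge_surj e; exact: VertexE.
Qed.

Lemma adj_uu i j : adj (uv i) (uv j) = false. Proof. by []. Qed.
Lemma adj_ee i j : adj (ev i) (ev j) = false. Proof. by []. Qed.
Lemma adj_uh i j h : adj (uv i) (hv j h) = false.
Proof. by rewrite /= inE. Qed.
Lemma adj_ue i j : adj (uv i) (ev j) = (i == j) || (i == ordS j).
Proof. by rewrite /= !inE. Qed.
Lemma adj_eh j i h : adj (ev j) (hv i h) = (i == j) || (i == ordS j).
Proof. by rewrite /= inE /= !inE. Qed.
Lemma adj_hh i h j k :
  adj (hv i h) (hv j k) = (i == j) && cycle_adj h k.
Proof. by []. Qed.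

Lemma card_neighbours_uv i : #|neighbours (uv i)| <= 2.
Proof.
apply: leq_trans (_ : #|[set ev i; ev (ord_pred i)]| <= _); last first.
  by rewrite cards2; case: eqP.
apply/subset_leq_card/subsetP => x; rewrite !inE.
case: (vertexP x) => [j|j|j h]; rewrite ?adj_uu ?adj_uh // adj_ue.
by case/orP => /eqP ->; rewrite ?ordSK eqxx ?orbT.
Qed.

Lemma card_neighbours_hv i h : #|neighbours (hv i h)| <= 4.
Proof.
pose s := [:: ev i; ev (ord_pred i); hv i (ordS h); hv i (ord_pred h)].
apply: leq_trans (_ : size s <= _) => //.
apply: leq_trans (card_size _).
apply/subset_leq_card/subsetP => x; rewrite !inE.
case: (vertexP x) => [j|j|j k]; rewrite adj_sym ?adj_uh // ?adj_eh ?adj_hh.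
  by case/orP => /eqP ->; rewrite ?ordSK eqxx ?orbT.
case/andP=> /eqP -> /andP[_ /orP[]] /eqP ->; last by rewrite eqxx !orbT.
by rewrite ordSK eqxx !orbT.
Qed.

Lemma card_neighbours_ev i : #|neighbours (ev i)| <= 2 * t + 2.
Proof.
pose q := map (hv i) (enum 'I_t) ++ map (hv (ordS i)) (enum 'I_t).
pose s := [:: uv i, uv (ordS i) & q].
have size_q : size q = t + t by rewrite size_cat !size_map -enumT size_enum_ord.
have <-: size s = 2 * t + 2 by rewrite -[size s]/(size q).+2 size_q; lia.
apply: leq_trans (card_size _).
apply/subset_leq_card/subsetP => x; rewrite !inE mem_cat.
case: (vertexP x) => [j|j|j h]; rewrite ?adj_ee // ?adj_eh 1?adj_sym ?adj_ue.
  by case/orP => /eqP ->; rewrite eqxx ?orbT.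
by case/orP => /eqP ->; rewrite map_f ?mem_enum ?orbT.
Qed.

End CycleCorona.

(** * Upper bounds from the degrees of b-vertices *)

Section BColoringBounds.
Variables (G : sgraph) (k : nat).

(** The colour of [x] and those of its neighbours exhaust all [k] colours. *)
Lemma b_vertex_degree (c : {ffun G -> 'I_k}) x :
  b_vertex c x -> k <= #|neighbours x|.+1.
Proof.
move/forallP=> bx; rewrite -[leqLHS]card_ord.
apply: leq_trans (_ : #|c x |: c @: neighbours x| <= _).
  apply/subset_leq_card/subsetP => j _; rewrite !inE.
  case: eqVneq => //= ne; have /existsP[y /andP[xy /eqP <-]] := implyP (bx j) ne.
  exact: imset_f.
rewrite cardsU1; apply: leq_trans (leq_add (leq_b1 _) (leq_imset_card _ _)) _.
by rewrite add1n.
Qed.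

Lemma b_vertices (c : {ffun G -> 'I_k}) :
  b_coloring c -> exists2 f : 'I_k -> G, injective f & forall i, b_vertex c (f i).
Proof.
case/andP=> _ /forallP bc.
pose f i := xchoose (existsP (bc i)).
have fP i := andP (xchooseP (existsP (bc i))).
exists f => [i j eq_f|i]; last by have [_] := fP i.
have [/eqP <- _] := fP i; have [/eqP <- _] := fP j.
by rewrite -/(f i) -/(f j) eq_f.
Qed.

End BColoringBounds.

Lemma b_chromatic_numberE (G : sgraph) k :
  b_colorable G k -> (forall l, b_colorable G l -> l <= k) ->
  b_chromatic_number G = k.
Proof.
move=> bk le_k; apply/eqP; rewrite eqn_leq b_colorable_leq // andbT.
by apply/bigmax_leqP => l; exact: le_k.
Qed.

Lemma cycle_corona_b_colorable_leq n t k : 2 < n -> 5 < k ->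
  b_colorable (svn_corona (cycle_graph n) (cycle_graph t)) k ->
  k <= n /\ k <= 2 * t + 3.
Proof.
move=> hn hk /existsP[c /b_vertices[f f_inj bf]].
(* A b-vertex has at least [k - 1 >= 5] neighbours, which excludes degrees 2 and 4. *)
have fE i : {j | f i = ev t hn j}.
  have := b_vertex_degree (bf i).
  case: (vertexP hn (f i)) => [j|j|j h]; last 1 first.
  - by have := card_neighbours_hv hn j h; lia.
  - by have := card_neighbours_uv t hn j; lia.
  by exists j.
split.
  rewrite -[k]card_ord -[n]card_ord.
  apply: (leq_card (fun i => sval (fE i))) => i j /= eq_ij.
  by apply: f_inj; rewrite (svalP (fE i)) (svalP (fE j)) eq_ij.
have k_gt0 : 0 < k by lia.
have := b_vertex_degree (bf (Ordinal k_gt0)).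
case: (fE (Ordinal k_gt0)) => j ->; have := card_neighbours_ev t hn j; lia.
Qed.

(** * Construction of b-colourings *)

(* [cu i], [ce i] and [ch i h] are the colours of the vertex [i], of the edge
   from [i] to [i + 1] and of the vertex [h] of the copy attached to [i]. *)
Lemma cycle_corona_b_colorable n t k (cu ce : nat -> nat) (ch : nat -> nat -> nat) :
  2 < n -> 1 < t ->
  (forall i, i < n -> [/\ cu i < k, ce i < k & forall h, h < t -> ch i h < k]) ->
  (forall i, i < n -> cu i <> ce i /\ cu (i.+1 %% n) <> ce i) ->
  (forall i h, i < n -> h < t -> ch i h <> ce i /\ ch (i.+1 %% n) h <> ce i) ->
  (forall i h, i < n -> h < t -> ch i h <> ch i (h.+1 %% t)) ->
  (forall a, a < k ->
     (exists i, [/\ i < n, ce i = a & forall l, l < k -> l <> a ->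
        [\/ l = cu i, l = cu (i.+1 %% n), exists2 h, h < t & l = ch i h
          | exists2 h, h < t & l = ch (i.+1 %% n) h]]) \/
     (exists i h, [/\ i < n, h < t, ch (i.+1 %% n) (h.+1 %% t) = a &
        forall l, l < k -> l <> a ->
        [\/ l = ce i, l = ce (i.+1 %% n), l = ch (i.+1 %% n) h
          | l = ch (i.+1 %% n) ((h.+1 %% t).+1 %% t)]])) ->
  b_colorable (svn_corona (cycle_graph n) (cycle_graph t)) k.
Proof.
move=> hn ht lt_k ne_ue ne_he ne_hh bP.
have k_gt0 : 0 < k by have [|+ _ _] := lt_k 0; lia.
case: k k_gt0 lt_k bP => // k _ lt_k bP.
set G := svn_corona _ _.
pose eidx e := sval (cycle_edge_surj hn e).
have eidxK i : eidx (cycle_edge hn i) = i.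
  by apply: (@cycle_edge_inj n hn); rewrite -(svalP (cycle_edge_surj hn _)).
pose c : {ffun G -> 'I_k.+1} := [ffun x => inord (match x with
  | inl (inl i) => cu (i : 'I_n) | inl (inr e) => ce (eidx e)
  | inr (i, h) => ch (i : 'I_n) (h : 'I_t) end)].
have cuE i : c (uv t i) = cu i :> nat.
  by rewrite ffunE inordK //; have [] := lt_k _ (ltn_ord i).
have ceE i : c (ev t hn i) = ce i :> nat.
  by rewrite ffunE /= eidxK inordK //; have [] := lt_k _ (ltn_ord i).
have chE i h : c (hv i h) = ch i h :> nat.
  by rewrite ffunE inordK //; have [_ _ ->] := lt_k _ (ltn_ord i).
have c_neq x y : c x <> c y :> nat -> c x != c y.
  by move=> ne; apply/eqP => /(congr1 val).
have c_ue i j : adj (uv t i) (ev t hn j) -> c (uv t i) != c (ev t hn j).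
  rewrite adj_ue => /orP[] /eqP ->; apply: c_neq; rewrite cuE ceE.
    by have [] := ne_ue _ (ltn_ord j).
  by have [] := ne_ue _ (ltn_ord j).
have c_eh j i h : adj (ev t hn j) (hv i h) -> c (ev t hn j) != c (hv i h).
  rewrite adj_eh => /orP[] /eqP ->; apply: c_neq; rewrite chE ceE => /esym.
    by have [] := ne_he _ _ (ltn_ord j) (ltn_ord h).
  by have [] := ne_he _ _ (ltn_ord j) (ltn_ord h).
have c_hh i h j l : adj (hv i h) (hv j l) -> c (hv i h) != c (hv j l).
  rewrite adj_hh => /andP[/eqP -> /andP[_ /orP[]]] /eqP ->; apply: c_neq; rewrite !chE.
    exact: ne_hh.
  by apply/nesym/ne_hh.
have c_proper : proper_coloring c.
  apply/forallP => x; apply/forallP => y; apply/implyP.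
  case: (vertexP hn x) => [i|i|i h]; case: (vertexP hn y) => [j|j|j l].
  - by rewrite adj_uu.
  - exact: c_ue.
  - by rewrite adj_uh.
  - by rewrite adj_sym eq_sym; exact: c_ue.
  - by rewrite adj_ee.
  - exact: c_eh.
  - by rewrite adj_sym adj_uh.
  - by rewrite adj_sym eq_sym; exact: c_eh.
  - exact: c_hh.
have b_vertexI x : (forall l : 'I_k.+1, l <> c x :> nat ->
    exists2 y, adj x y & c y = l :> nat) -> b_vertex c x.
  move=> H; apply/forallP => l; apply/implyP; rewrite -val_eqE => /eqP /H [y xy cy].
  by apply/existsP; exists y; rewrite inE xy -val_eqE /= cy eqxx.
apply/existsP; exists c; rewrite /b_coloring c_proper.
apply/forallP => a; apply/existsP.
have [[i [lt_in ca H]]|[i [h [lt_in lt_ht ca H]]]] := bP _ (ltn_ord a).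
  pose i' := Ordinal lt_in; exists (ev t hn i').
  rewrite -val_eqE /= ceE ca eqxx b_vertexI // => l; rewrite ceE ca => ne_la.
  have [-> | -> | [h lt_ht ->] | [h lt_ht ->]] := H l (ltn_ord l) ne_la.
  - by exists (uv t i'); rewrite ?cuE // adj_sym adj_ue eqxx.
  - by exists (uv t (ordS i')); rewrite ?cuE // adj_sym adj_ue eqxx orbT.
  - by exists (hv i' (Ordinal lt_ht)); rewrite ?chE // adj_eh eqxx.
  - by exists (hv (ordS i') (Ordinal lt_ht)); rewrite ?chE // adj_eh eqxx orbT.
(* The b-vertex is at block [i + 1], position [h + 1], so that its four neighbours are described
   without predecessors. *)
pose i' := Ordinal lt_in; pose h' := Ordinal lt_ht.
exists (hv (ordS i') (ordS h')).
rewrite -val_eqE /= chE ca eqxx b_vertexI // => l; rewrite chE ca => ne_la.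
have [-> | -> | -> | ->] := H l (ltn_ord l) ne_la.
- by exists (ev t hn i'); rewrite ?ceE // adj_sym adj_eh eqxx orbT.
- by exists (ev t hn (ordS i')); rewrite ?ceE // adj_sym adj_eh eqxx.
- exists (hv (ordS i') h'); rewrite ?chE // adj_sym adj_hh eqxx.
  exact: cycle_adj_ordS.
- exists (hv (ordS i') (ordS (ordS h'))); rewrite ?chE // adj_hh eqxx.
  exact: cycle_adj_ordS.
Qed.

Lemma cycle_corona_large_b_colorable n t k : 2 < t -> 5 <= k <= n -> k <= 2 * t + 3 ->
  b_colorable (svn_corona (cycle_graph n) (cycle_graph t)) k.
Proof.
move=> ht /andP[k5 le_kn] le_kt.
(* [off i d] is the colour [s - d] modulo [k], where the shift [s] of the
   [i]-th block is [i] for [i < k] and [0] afterwards; thus the two edges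
   meeting [i] only use the offsets [d = 0, 1], and colours with offset [d] in
   block [i] and [d + 1] in block [i + 1] agree for [i < k].  Hence the edge
   [i] is a b-vertex as soon as every block uses the offsets 2, 4, 6, ... and
   [k - 1]: these take at most [t + 1] vertices when [k <= 2 * t + 3]. *)
pose off i d := if i < k then (if d <= i then i - d else i + k - d) else k - d.
(* The first [k./2.-1 <= t] positions of a copy carry the offsets 4, 6, ... and [k - 1]; the others
   alternate 2 and 3. Offset 2 is always present on the cycle vertex. *)
pose f j := if j < k./2.-1 then minn (2 * j + 4) k.-1 else 2 + odd j.
have f_bnd j : 2 <= f j < k by rewrite /f; case: ifP; lia.
have off_lt i d : 2 <= d < k -> off i d < k by rewrite /off; repeat case: ifP; lia.
have off_min i d : i < n -> 2 <= d < k ->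
    off i d <> minn i k.-1 /\ off (i.+1 %% n) d <> minn i k.-1.
  by move=> lt_in dP; rewrite modnS_lt // /off; repeat case: ifP; lia.
have off_inj i d e : 2 <= d < k -> 2 <= e < k -> off i d = off i e -> d = e.
  by rewrite /off; repeat case: ifP; lia.
(* Edges from index [k - 1] on share the colour [k - 1], which has offset 1 in every block of shift
   0. *)
apply: (@cycle_corona_b_colorable n t k (fun i => off i 2) (fun i => minn i k.-1)
          (fun i j => off i (f j))) => //; try lia.
- by move=> i lt_in; split=> [||h _]; rewrite ?off_lt //; lia.
- by move=> i lt_in; apply: off_min; lia.
- by move=> i h lt_in _; apply: off_min.
- move=> i h _ lt_ht /off_inj; rewrite !f_bnd => /(_ isT isT).
  by rewrite modnS_lt // /f; repeat case: ifP; lia.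
move=> a lt_ak; left; exists a; split=> [||l lt_lk ne_la]; try lia.
pose d := if l <= a then a - l else a + k - l.
have dE : 0 < d < k by rewrite /d; case: ifP; lia.
have l_off : l = off a d by rewrite /off /d; repeat case: ifP; lia.
have l_off1 : d.+1 < k -> l = off (a.+1 %% n) d.+1.
  by rewrite modnS_lt ?/off /d; repeat case: ifP; rewrite ?ltn0; lia.
have f_even e : 4 <= e < k -> ~~ odd e || (e == k.-1) -> exists2 j, j < t & e = f j.
  (* For even [e] this solves [2 * j + 4 = e]; for odd [e = k - 1] it gives [2 * j + 4 = k], which
     [minn] lowers to [k - 1]. *)
  by move=> eP e_even; exists (uphalf e - 2); rewrite /f; try case: ifP; lia.
(* An even offset [d] occurs in block [a]; an odd one occurs as [d + 1] in block [a + 1], except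
   [d = k - 1], found in block [a]. *)
have [d_odd|d_even] := boolP (odd d); last first.
  have [d2|d_neq2] := eqVneq d 2; first by constructor 1; rewrite -d2.
  have [||j lt_jt ej] := f_even d; rewrite ?d_even //; first lia.
  by constructor 3; exists j; rewrite // -ej.
have [d1|d_neq1] := eqVneq d 1; first by constructor 2; rewrite l_off1 d1 //; lia.
have [lt_dk|le_kd] := ltnP d.+1 k.
  have [||j lt_jt ej] := f_even d.+1; [lia|lia|].
  by constructor 4; exists j; rewrite // -ej l_off1.
have [||j lt_jt ej] := f_even d; [lia|lia|].
by constructor 3; exists j; rewrite // -ej.
Qed.

(** Of the edge colours 0, 1, 2, only [i + 1] modulo 3 is free in the copy at [i]: position 0 takes
    it, the others alternate 3 and 4. The copy at 0 alternates in the opposite order, so that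
    position 1 yields b-vertices of both colours. *)
Lemma cycle_corona3_b_colorable t : 2 < t ->
  b_colorable (svn_corona (cycle_graph 3) (cycle_graph t)) 5.
Proof.
move=> ht.
pose ch i j := if j == 0 then i.+1 %% 3 else if odd j == (i == 0) then 3 else 4.
apply: (@cycle_corona_b_colorable 3 t 5 (fun=> 3) id ch) => //; rewrite ?/ch.
- by lia.
- by move=> i lt_in; split=> // [|h _]; repeat case: ifP; lia.
- by move=> i lt_in; lia.
- by move=> i h lt_in lt_ht; repeat case: ifP; lia.
- by move=> i h lt_in lt_ht; rewrite (modnS_lt lt_ht); repeat case: ifP; lia.
move=> a lt_a5; have [lt_a3|le_3a] := ltnP a 3.
  left; exists a; split=> // l lt_l5 ne_la.
  have [l_next|ne_l_next] := eqVneq l (a.+1 %% 3).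
    by constructor 3; exists 0; first lia.
  have [l_prev|ne_l_prev] := eqVneq l (a.+2 %% 3).
    by constructor 4; exists 0; rewrite /=; lia.
  have [l3|l4] : l = 3 \/ l = 4 by lia.
    by constructor 1.
  by constructor 3; exists (if a == 0 then 2 else 1); case: (a == 0); rewrite /=; lia.
right; have [modt1 modt2] : 1 %% t = 1 /\ 2 %% t = 2 by rewrite !modn_small //; lia.
have [a3|a4] : a = 3 \/ a = 4 by lia.
  (* Taking successors, these indices denote position 1 of the copy at 0; for colour 4, it is
     position 1 of the copy at 1. *)
  exists 2, 0; rewrite !modt1 !modt2 a3; split=> //; first lia.
  move=> [|[|[|[|[|l]]]]] //= _ _.
  - by constructor 2.
  - by constructor 3.
  - by constructor 1.
  - by constructor 4.
exists 0, 0; rewrite !modt1 !modt2 a4; split=> //; first lia.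
move=> [|[|[|[|[|l]]]]] //= _ _.
- by constructor 1.
- by constructor 2.
- by constructor 3.
- by constructor 4.
Qed.

(** The copy at [i] may use the edge colours [i + 1] and [i + 2] modulo 4. They surround position 1,
    of colour 4, whose two edges supply the remaining colours. *)
Lemma cycle_corona4_b_colorable t : 2 < t ->
  b_colorable (svn_corona (cycle_graph 4) (cycle_graph t)) 5.
Proof.
move=> ht.
pose ch i j := if j == 0 then i.+1 %% 4 else if odd j then 4 else i.+2 %% 4.
apply: (@cycle_corona_b_colorable 4 t 5 (fun=> 4) id ch) => //; rewrite ?/ch.
- by lia.
- by move=> i lt_in; split=> // [|h _]; repeat case: ifP; lia.
- by move=> i lt_in; lia.
- by move=> i h lt_in lt_ht; repeat case: ifP; lia.
- by move=> i h lt_in lt_ht; rewrite (modnS_lt lt_ht); repeat case: ifP; lia.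
move=> a lt_a5; have [lt_a4|le_4a] := ltnP a 4.
  left; exists a; split=> // l lt_l5 ne_la.
  have [l4|ne_l4] := eqVneq l 4; first by constructor 1.
  have [l1|ne_l1] := eqVneq l (a.+1 %% 4).
    by constructor 3; exists 0; first lia.
  have [l2|ne_l2] := eqVneq l (a.+2 %% 4).
    by constructor 3; exists 2.
  by constructor 4; exists 2; rewrite /=; lia.
right; have [modt1 modt2] : 1 %% t = 1 /\ 2 %% t = 2 by rewrite !modn_small //; lia.
exists 0, 0; rewrite !modt1 !modt2; split=> //; [lia | by rewrite /=; lia |].
move=> [|[|[|[|l]]]] //= lt_l5 ne_la; last lia.
- by constructor 1.
- by constructor 2.
- by constructor 3.
- by constructor 4.
Qed.

Theorem theorem12 (n t : nat) (hn : 2 < n) (ht : 2 < t) :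
  b_chromatic_number (svn_corona (cycle_graph n) (cycle_graph t)) =
    if n \in [:: 3; 4] then 5
    else if 5 <= n <= 2 * t + 2 then n
    else 2 * t + 3.
Proof.
apply: b_chromatic_numberE => [|k bk].
  rewrite !inE; case: ifP => [/orP[] /eqP ->|n_neq34].
  - exact: cycle_corona3_b_colorable.
  - exact: cycle_corona4_b_colorable.
  by case: ifP => le_n; apply: cycle_corona_large_b_colorable; lia.
(* Every value of the formula is at least 5, so the degree bounds are used only for [k > 5]. *)
have [le_k5|lt_5k] := leqP k 5; first by rewrite !inE; repeat case: ifP; lia.
have [le_kn le_kt] := cycle_corona_b_colorable_leq hn lt_5k bk.
by rewrite !inE; repeat case: ifP; lia.
Qed.
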